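(* Let $N\ge 1$ and let $x,y\in\mathbb{R}^N_{+}$ be two vectors such that $x\ll y$ ($x$ is strongly majorized by $y$) and $y_1+\dots+y_N\neq 0$. Put $$\alpha=\frac{x_1+\dots+x_N}{y_1+\dots+y_N}.$$ Then for each convex function $f:\mathbb{R}_+\to\mathbb{R}$ we have $$\frac{f(x_1)+\dots+f(x_N)}{N}\le \alpha\,\frac{f(y_1)+\dots+f(y_N)}{N}+(1-\alpha)f(0).$$
   Context: $\mathbb{R}_+=[0,\infty)$, and $\mathbb{R}^N_+$ is the set of vectors in $\mathbb{R}^N$ with all coordinates in $\mathbb{R}_+$. For $x\in\mathbb{R}^N$, $x_{[i]}$ denotes the $i$-th largest component of $x$ (so $x_{[1]}\ge x_{[2]}\ge\dots\ge x_{[N]}$ is the decreasing rearrangement of $x$). Definition (strong majorization). For $x,y\in\mathbb{R}^N$, $x$ is strongly majorized by $y$, written $x\ll y$, if for each $k=1,2,\dots,N-1$ $$\Big(\sum_{i=1}^k x_{[i]}\Big)\Big(\sum_{i=k+1}^N y_{[i]}\Big)\le \Big(\sum_{i=1}^{k} y_{[i]}\Big)\Big(\sum_{i=k+1}^N x_{[i]}\Big),$$ and moreover $$\sum_{i=1}^N x_{[i]}\le\sum_{i=1}^N y_{[i]}.$$ *)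

(* Defs.v *)
From mathcomp Require Import all_boot all_order all_algebra.
From mathcomp Require Import classical_sets set_interval reals convex.

Set Implicit Arguments.
Unset Strict Implicit.
Unset Printing Implicit Defensive.

Import Order.TTheory GRing.Theory Num.Theory.
Local Open Scope ring_scope.

(* x_[i], the i-th largest component of x. The index i is 1-based: it is
   meaningful for 1 <= i <= N (out of range, i = 0 gives x_[1] and i > N
   gives 0). *)
Definition decr (R : realType) (N : nat) (x : 'rV[R]_N) (i : nat) : R :=
  (sort >=%R [seq x ord0 j | j : 'I_N])`_i.-1.

Definition strong_majorized (R : realType) (N : nat) (x y : 'rV[R]_N) : Prop :=
  (forall k : nat, (1 <= k <= N.-1)%N ->
     (\sum_(1 <= i < k.+1) decr x i) * (\sum_(k.+1 <= i < N.+1) decr y i) <=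
     (\sum_(1 <= i < k.+1) decr y i) * (\sum_(k.+1 <= i < N.+1) decr x i)) /\
  \sum_(1 <= i < N.+1) decr x i <= \sum_(1 <= i < N.+1) decr y i.

(* Main.v *)
(** Strong majorization says exactly that [x] is majorized, in the classical
    sense, by [alpha y]: adding the product of the two head sums to both sides
    of the [k]-th inequality gives [X_k Y <= Y_k X].  Karamata's inequality
    then bounds [sum f(x_i)] by [sum f(alpha y_i)], and convexity between [0]
    and [y_i] finishes, since [0 <= alpha <= 1].  Karamata is proved by Abel
    summation against the chord slopes [(f b_i - f a_i) / (b_i - a_i)], which
    decrease with [i]; unlike subgradients these exist even if [f] jumps, or has
    infinite slope, at [0]. *)
Require Import Defs.
From mathcomp Require Import all_boot all_order all_algebra.
From mathcomp Require Import classical_sets set_interval reals convex.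
From mathcomp Require Import interval_inference.
From mathcomp Require Import ring lra.

Set Implicit Arguments.
Unset Strict Implicit.
Unset Printing Implicit Defensive.

Import Order.TTheory GRing.Theory Num.Theory.
Local Open Scope ring_scope.

Lemma convex_ge0P (R : realType) (f : R -> R) (t u v : R) :
  convex_function (`[0, +oo[%classic : set R^o) f ->
  0 <= t -> t <= 1 -> 0 <= u -> 0 <= v ->
  f (t * u + (1 - t) * v) <= t * f u + (1 - t) * f v.
Proof.
move=> cf t0 t1 u0 v0.
have in0 (a : R) : 0 <= a -> a \in (`[0, +oo[%classic : set R^o).
  by move=> a0; rewrite inE /= in_itv /= a0.
have := cf (Itv01 t0 t1) u v (in0 _ u0) (in0 _ v0).
by rewrite !convRE.
Qed.

(** The point [q] is the convex combination of [p] and [r] with weight [(r - q) / (r - p)] on [p].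
    Denominators are cleared so that slope comparisons follow by [lra]. *)
Lemma convex_chord (R : realType) (f : R -> R) (p q r : R) :
  convex_function (`[0, +oo[%classic : set R^o) f ->
  0 <= p -> p < q -> q < r ->
  (r - p) * f q <= (r - q) * f p + (q - p) * f r.
Proof.
move=> cf p0 pq qr.
have rp0 : 0 < r - p by lra.
have rpN0 : r - p != 0 by rewrite gt_eqF.
have t0 : 0 <= (r - q) / (r - p) by rewrite divr_ge0; lra.
have t1 : (r - q) / (r - p) <= 1 by rewrite ler_pdivrMr // mul1r; lra.
have r0 : 0 <= r by lra.
have := convex_ge0P cf t0 t1 p0 r0.
have -> : (r - q) / (r - p) * p + (1 - (r - q) / (r - p)) * r = q by field.
rewrite -(ler_pM2l rp0); congr (_ <= _).
by field.
Qed.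

Definition slope (R : realType) (f : R -> R) (u v : R) : R :=
  (f v - f u) / (v - u).

Lemma slopeC (R : realType) (f : R -> R) (u v : R) : slope f u v = slope f v u.
Proof. by rewrite /slope -(opprB v u) invrN mulrN -mulNr opprB. Qed.

Lemma slopeM (R : realType) (f : R -> R) (u v : R) :
  u != v -> slope f u v * (v - u) = f v - f u.
Proof. by move=> uv; rewrite /slope divfK // subr_eq0 eq_sym. Qed.

(** Each position of [w] relative to [u < v] reduces to the chord inequality at the three points in
    increasing order. *)
Lemma slope_homo (R : realType) (f : R -> R) (w u v : R) :
  convex_function (`[0, +oo[%classic : set R^o) f ->
  0 <= w -> 0 <= u -> w != u -> w != v -> u <= v -> slope f w u <= slope f w v.
Proof.
move=> cf w0 u0 wu wv; rewrite le_eqVlt => /predU1P[-> //|uv].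
case: (ltgtP w u) wu => // [wu|uw] _.
  have chord := @convex_chord _ _ _ _ _ cf w0 wu uv.
  rewrite /slope ler_pdivrMr; last by lra.
  rewrite mulrAC ler_pdivlMr; last by lra.
  by lra.
rewrite slopeC; case: (ltgtP w v) wv => // [wv|vw] _.
  have chord := @convex_chord _ _ _ _ _ cf u0 uw wv.
  rewrite /slope ler_pdivrMr; last by lra.
  rewrite mulrAC ler_pdivlMr; last by lra.
  by lra.
have chord := @convex_chord _ _ _ _ _ cf u0 uv vw.
rewrite (slopeC f w v) /slope ler_pdivrMr; last by lra.
rewrite mulrAC ler_pdivlMr; last by lra.
by lra.
Qed.

(** The endpoints move one at a time, through the chord from [a] to [d]. *)
Lemma slope_homo2 (R : realType) (f : R -> R) (a b c d : R) :
  convex_function (`[0, +oo[%classic : set R^o) f ->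
  0 <= a -> 0 <= b -> a <= c -> b <= d -> a != b -> c != d ->
  slope f a b <= slope f c d.
Proof.
move=> cf a0 b0 ac bd ab cd.
have c0 : 0 <= c by lra.
have d0 : 0 <= d by lra.
have [ad|ad] := eqVneq a d.
  (* That chord degenerates when [a = d]; then [b < c], and the chord from [b] to [c] serves
     instead. *)
  have bc : b != c by apply/eqP => bc; move/eqP: ab; lra.
  subst d; rewrite slopeC (slopeC f c).
  apply: (le_trans (y := slope f b c)).
    by apply: slope_homo => //; rewrite eq_sym.
  by rewrite slopeC (slopeC f a); apply: slope_homo => //; rewrite eq_sym.
apply: (le_trans (y := slope f a d)); first exact: slope_homo.
by rewrite slopeC (slopeC f c); apply: slope_homo => //; rewrite eq_sym.
Qed.

(* The hypothesis on [c] is weighted by the total gap so that it is void when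
   the totals agree, which is the case of interest, yet carries through the
   induction on [m] with [c] the last slope. *)
Lemma abel_slope (R : realType) (f : R -> R) (a b : nat -> R) (m : nat) (c : R) :
  convex_function (`[0, +oo[%classic : set R^o) f ->
  (forall i, (i < m)%N -> 0 <= a i) -> (forall i, (i < m)%N -> 0 <= b i) ->
  (forall i j, (i <= j < m)%N -> a j <= a i) ->
  (forall i j, (i <= j < m)%N -> b j <= b i) ->
  (forall k, (k <= m)%N -> 0 <= \sum_(0 <= i < k) (b i - a i)) ->
  (forall i, (i < m)%N -> a i != b i ->
     c * \sum_(0 <= j < m) (b j - a j) <=
     slope f (a i) (b i) * \sum_(0 <= j < m) (b j - a j)) ->
  c * \sum_(0 <= j < m) (b j - a j) <= \sum_(0 <= j < m) (f (b j) - f (a j)).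
Proof.
move=> cf; elim: m c => [|m IH] c a0 b0 amono bmono gap cslope.
  by rewrite !big_geq // mulr0.
have {}IH c' := IH c' (fun i im => a0 i (ltnW im)) (fun i im => b0 i (ltnW im)).
have lift_mono (g : nat -> R) : (forall i j, (i <= j < m.+1)%N -> g j <= g i) ->
    forall i j, (i <= j < m)%N -> g j <= g i.
  by move=> gm i j /andP[ij jm]; apply: gm; rewrite ij ltnW.
have {}IH c' := IH c' (lift_mono _ amono) (lift_mono _ bmono)
  (fun k km => gap k (leqW km)).
have gapm := gap m (leqnSn m).
have gapm1 := gap m.+1 (leqnn _).
rewrite !big_nat_recr //= in cslope gapm1 *.
have [eab|nab] := eqVneq (a m) (b m).
  rewrite eab !subrr !addr0 in cslope *.
  by apply: IH => i im; apply: cslope; rewrite ltnW.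
(* Trade [c] for the slope at index [m], which matches the last term exactly. Slopes at earlier
   indices are at least as large, so the induction hypothesis applies with this new constant. *)
apply: le_trans (cslope m (ltnSn m) nab) _.
rewrite mulrDr slopeM // lerD2r.
apply: IH => i im nabi; apply: ler_wpM2r => //.
by apply: slope_homo2; rewrite ?a0 ?b0 ?amono ?bmono ?(ltnW im) /=.
Qed.

Lemma karamata (R : realType) (f : R -> R) (a b : nat -> R) (m : nat) :
  convex_function (`[0, +oo[%classic : set R^o) f ->
  (forall i, (i < m)%N -> 0 <= a i) -> (forall i, (i < m)%N -> 0 <= b i) ->
  (forall i j, (i <= j < m)%N -> a j <= a i) ->
  (forall i j, (i <= j < m)%N -> b j <= b i) ->
  (forall k, (k <= m)%N ->
     \sum_(0 <= i < k) a i <= \sum_(0 <= i < k) b i) ->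
  \sum_(0 <= i < m) a i = \sum_(0 <= i < m) b i ->
  \sum_(0 <= i < m) f (a i) <= \sum_(0 <= i < m) f (b i).
Proof.
move=> cf a0 b0 amono bmono le_ab eq_ab.
have gap0 : \sum_(0 <= i < m) (b i - a i) = 0 by rewrite sumrB eq_ab subrr.
(* The left-hand side 0 is written as [c] times the total gap, with [c = 0]. *)
rewrite -subr_ge0 -sumrB -[leLHS](mul0r (\sum_(0 <= i < m) (b i - a i))).
apply: abel_slope => // [k km|i _ _]; last by rewrite gap0 !mulr0.
by rewrite sumrB subr_ge0 le_ab.
Qed.

Section DecreasingRearrangement.
Variables (R : realType) (N : nat) (x : 'rV[R]_N).

Let s := sort >=%R [seq x ord0 j | j : 'I_N].

Let size_s : size s = N.
Proof. by rewrite size_sort size_map size_enum_ord. Qed.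

(** Sorting only permutes the entries. A general [F] covers the totals, the scaled totals and the
    sums of values of [f]. *)
Lemma sum_decr (F : R -> R) :
  \sum_(0 <= i < N) F (decr x i.+1) = \sum_(j < N) F (x ord0 j).
Proof.
transitivity (\sum_(u <- s) F u); first by rewrite [RHS](big_nth 0) size_s.
by rewrite (perm_big _ (permEl (perm_sort _ _))) big_image.
Qed.

Lemma decr_mono (i j : nat) : (i <= j < N)%N -> decr x j.+1 <= decr x i.+1.
Proof.
move=> /andP[ij jN]; rewrite /decr /=.
have ge_total : total (>=%R : rel R) by move=> u v; exact: le_total.
have ge_trans : transitive (>=%R : rel R).
  by move=> v u w /= vu wv; exact: le_trans wv vu.
have ge_refl : reflexive (>=%R : rel R) by move=> u /=.
apply: (sorted_leq_nth ge_trans ge_refl 0 (sort_sorted ge_total _) i j) => //.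
  by rewrite inE size_s (leq_ltn_trans ij).
by rewrite inE size_s.
Qed.

Lemma decr_ge0 (i : nat) :
  (forall j, 0 <= x ord0 j) -> (i < N)%N -> 0 <= decr x i.+1.
Proof.
move=> x0 iN; have : s`_i \in s by rewrite mem_nth // size_s.
by rewrite mem_sort => /mapP[j _]; rewrite /decr /= -/s => ->.
Qed.

End DecreasingRearrangement.

Lemma strong_majorized_head (R : realType) (N : nat) (x y : 'rV[R]_N) (k : nat) :
  strong_majorized x y -> (k <= N)%N ->
  (\sum_(0 <= i < k) decr x i.+1) * \sum_(j < N) y ord0 j <=
  (\sum_(0 <= i < k) decr y i.+1) * \sum_(j < N) x ord0 j.
Proof.
move=> [maj _] kN; rewrite -(sum_decr x id) -(sum_decr y id).
(* The definition covers only [1 <= k <= N.-1]. At [k = 0] both sides vanish; at [k = N] they are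
   the same product. *)
have [->|k0] := posnP k; first by rewrite !(@big_geq _ _ _ 0 0) // !mul0r.
move: kN; rewrite leq_eqVlt => /predU1P[->|kN]; first by rewrite mulrC.
have kN1 : (1 <= k <= N.-1)%N by rewrite k0 -ltnS prednK // (leq_ltn_trans _ kN).
move: (maj k kN1).
rewrite !big_add1 /= => tail.
have split_at (z : 'rV[R]_N) : \sum_(0 <= i < N) decr z i.+1 =
    \sum_(0 <= i < k) decr z i.+1 + \sum_(k <= i < N) decr z i.+1.
  by rewrite (@big_cat_nat _ _ _ k) // ltnW.
(* Both sides now contain the product of the two head sums, which cancels. *)
rewrite !split_at !mulrDr [leLHS]addrC [leRHS]addrC.
by rewrite [X in _ + X <= _]mulrC lerD2r.
Qed.

Theorem theorem4 (R : realType) (N : nat) (x y : 'rV[R]_N) (hN : (1 <= N)%N)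
  (hx : forall i, 0 <= x ord0 i) (hy : forall i, 0 <= y ord0 i)
  (hxy : strong_majorized x y) (hy0 : \sum_(i < N) y ord0 i != 0) :
  let alpha := (\sum_(i < N) x ord0 i) / (\sum_(i < N) y ord0 i) in
  forall f : R -> R,
    convex_function (`[0, +oo[%classic : set R^o) f ->
    (\sum_(i < N) f (x ord0 i)) / N%:R <=
      alpha * ((\sum_(i < N) f (y ord0 i)) / N%:R) + (1 - alpha) * f 0.
Proof.
move=> alpha f cf.
have Y0 : 0 < \sum_(i < N) y ord0 i by rewrite lt_def hy0 sumr_ge0.
have alpha0 : 0 <= alpha by rewrite divr_ge0 ?sumr_ge0.
have alpha1 : alpha <= 1.
  rewrite ler_pdivrMr // mul1r; case: hxy => _.
  by rewrite !big_add1 (sum_decr x id) (sum_decr y id).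
have head k : (k <= N)%N ->
    \sum_(0 <= i < k) decr x i.+1 <= \sum_(0 <= i < k) alpha * decr y i.+1.
  (* Multiplying by the positive total of [y] clears the denominator of [alpha]. *)
  move=> kN; rewrite -mulr_sumr mulrAC ler_pdivlMr // [leRHS]mulrC.
  exact: strong_majorized_head.
have kar : \sum_(0 <= i < N) f (decr x i.+1) <=
    \sum_(0 <= i < N) f (alpha * decr y i.+1).
  apply: (@karamata _ _ (fun i => decr x i.+1) (fun i => alpha * decr y i.+1)) => //.
  - by move=> i; apply: decr_ge0.
  - by move=> i iN; rewrite mulr_ge0 // decr_ge0.
  - exact: decr_mono.
  - by move=> i j ij; rewrite ler_wpM2l // decr_mono.
  - by rewrite (sum_decr x id) (sum_decr y (fun u => alpha * u)) -mulr_sumr divfK.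
(* Both sums are symmetric in the entries, so the original order can be restored. *)
rewrite (sum_decr x f) (sum_decr y (fun u => f (alpha * u))) in kar.
have N0 : 0 < N%:R :> R by rewrite ltr0n.
have star : \sum_(i < N) f (alpha * y ord0 i) <=
    \sum_(i < N) (alpha * f (y ord0 i) + (1 - alpha) * f 0).
  apply: ler_sum => i _.
  by have := convex_ge0P cf alpha0 alpha1 (hy i) (lexx 0); rewrite mulr0 addr0.
rewrite ler_pdivrMr // (le_trans kar) // (le_trans star) //.
rewrite big_split /= -mulr_sumr sumr_const card_ord -[_ *+ N]mulr_natr.
by rewrite [leRHS]mulrDl -[alpha * _ * N%:R]mulrA divfK ?gt_eqF.
Qed.
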